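(* If $H$ is a graph with $n$ vertices, chromatic number $q$, and maximum degree $\Delta$, then $r(H) \leq 2^{4q\Delta}n$.
   Context: For a graph $H$, the Ramsey number $r(H)$ is the least positive integer $N$ such that every 2-coloring of the edges of the complete graph $K_N$ contains a monochromatic copy of $H$. *)

(* Defs.v *)
From mathcomp Require Import all_boot.

Set Implicit Arguments.
Unset Strict Implicit.
Unset Printing Implicit Defensive.

Record sgraph := SGraph {
  vertex :> finType;
  adj : rel vertex;
  adj_sym : symmetric adj;
  adj_irrefl : irreflexive adj
}.

Definition degree (H : sgraph) (x : H) : nat := #|[set y | adj x y]|.

Definition max_degree (H : sgraph) : nat := \max_(x : H) degree x.

Definition colorable (H : sgraph) (k : nat) : bool :=
  [exists f : {ffun H -> 'I_k}, forall x, forall y, adj x y ==> (f x != f y)].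

Lemma colorable_ex (H : sgraph) : exists k, colorable H k.
Proof.
exists #|H|; apply/existsP; exists [ffun x => enum_rank x].
apply/forallP=> x; apply/forallP=> y; apply/implyP=> xy; rewrite !ffunE.
by apply/eqP=> /enum_rank_inj eqxy; rewrite eqxy adj_irrefl in xy.
Qed.

Definition chromatic_number (H : sgraph) : nat := ex_minn (colorable_ex H).

(* The edges of K_N are the 2-element subsets of 'I_N. A 2-coloring is given
   by a function on all subsets; only its values on 2-element subsets are
   used, since c is evaluated at [set f x; f y] only for adjacent x, y (hence
   x != y) and injective f. *)
Definition mono_copy (H : sgraph) (N : nat) (c : {ffun {set 'I_N} -> bool})
    : bool :=
  [exists b : bool, exists f : {ffun H -> 'I_N},
     injectiveb f &&
     [forall x, forall y, adj x y ==> (c [set f x; f y] == b)]].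

Definition ramsey_arrow (H : sgraph) (N : nat) : bool :=
  [forall c : {ffun {set 'I_N} -> bool}, mono_copy H c].

Lemma ramsey_clique (T : finType) (c : {set T} -> bool) (a1 a0 : nat)
    (A : {set T}) :
  2 ^ (a1 + a0) <= #|A| ->
  exists b : bool, exists S : {set T},
    [/\ #|S| = (if b then a1 else a0), S \subset A &
        {in S &, forall x y, x != y -> c [set x; y] = b}].
Proof.
have [m] := ubnP (a1 + a0); elim: m a1 a0 A => // m IH a1 a0 A.
case: a1 => [|a1] lem leA.
  by exists true, set0; split; rewrite ?cards0 ?sub0set // => x y; rewrite inE.
case: a0 => [|a0] in lem leA *.
  by exists false, set0; split; rewrite ?cards0 ?sub0set // => x y; rewrite inE.
have /card_gt0P[v vA] : 0 < #|A| by apply: leq_trans leA; rewrite expn_gt0.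
pose Nb b := [set y in A :\ v | c [set v; y] == b].
have ext b (S : {set T}) : S \subset Nb b ->
    {in S &, forall x y, x != y -> c [set x; y] = b} ->
  [/\ #|v |: S| = #|S|.+1, v |: S \subset A &
     {in v |: S &, forall x y, x != y -> c [set x; y] = b}].
  move=> /subsetP sSN cS.
  have SN y : y \in S -> [/\ y != v, y \in A & c [set v; y] = b].
    by move=> /sSN; rewrite !inE => /andP[/andP[-> ->] /eqP].
  split.
  - by rewrite cardsU1; case: (boolP (v \in S)) => // /SN[]; rewrite eqxx.
  - apply/subsetP=> y; rewrite !inE => /orP[/eqP-> // | /SN[]//].
  move=> x y; rewrite !inE => /orP[/eqP->|xS] /orP[/eqP->|yS] nxy.
  - by rewrite eqxx in nxy.
  - by have [] := SN _ yS.
  - by rewrite setUC; have [] := SN _ xS.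
  exact: cS.
have NbA b : Nb b \subset A.
  by apply/subsetP=> y; rewrite !inE => /andP[/andP[]].
have cardN : #|A| = (#|Nb true| + #|Nb false|).+1.
  rewrite (cardsD1 v) vA add1n; congr _.+1.
  rewrite -(cardsID [set y | c [set v; y]] (A :\ v)); congr (_ + _);
    apply: eq_card => y; rewrite !inE; case: (c _); rewrite ?andbT ?andbF //.
have [leT|ltT] := leqP (2 ^ (a1 + a0.+1)) #|Nb true|.
  have [|b [S [cS sS hS]]] := IH a1 a0.+1 _ _ leT; first by rewrite -ltnS.
  case: b cS hS => cS hS; last by exists false, S; rewrite (subset_trans sS).
  by have [e1 e2 e3] := ext _ _ sS hS; exists true, (v |: S); rewrite e1 cS.
have leF : 2 ^ (a1.+1 + a0) <= #|Nb false|.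
  rewrite leqNgt; apply/negP=> ltF; move: leA; rewrite cardN leqNgt => /negP[].
  rewrite [a1.+1 + _]addSn expnS mul2n -addnn -addSn -addnS.
  by apply: leq_add => //; rewrite addnS -addSn.
have [|b [S [cS sS hS]]] := IH a1.+1 a0 _ _ leF.
  by rewrite -ltnS -addnS.
case: b cS hS => cS hS; first by exists true, S; rewrite (subset_trans sS).
by have [e1 e2 e3] := ext _ _ sS hS; exists false, (v |: S); rewrite e1 cS.
Qed.

Lemma ramsey_ex (H : sgraph) : exists N, (0 < N) && ramsey_arrow H N.
Proof.
exists (2 ^ (#|H| + #|H|)); rewrite expn_gt0 /=; apply/forallP=> c.
have [|b [S [cS _ hS]]] := @ramsey_clique _ c #|H| #|H| setT.
  by rewrite cardsT card_ord.
have {}cS : #|H| = #|S| by rewrite cS if_same.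
pose f x := enum_val (cast_ord cS (enum_rank x)) : 'I_(2 ^ (#|H| + #|H|)).
have f_inj : injective f by move=> x y /enum_val_inj/cast_ord_inj/enum_rank_inj.
apply/existsP; exists b; apply/existsP; exists (finfun f); apply/andP; split.
  by apply/injectiveP=> x y; rewrite !ffunE => /f_inj.
apply/forallP=> x; apply/forallP=> y; apply/implyP=> xy; rewrite !ffunE.
apply/eqP/hS; rewrite ?enum_valP // (inj_eq f_inj).
by apply/eqP=> eqxy; rewrite eqxy adj_irrefl in xy.
Qed.

Definition ramsey_number (H : sgraph) : nat := ex_minn (ramsey_ex H).

(* Main.v *)
Require Import Defs.
From mathcomp Require Import all_boot zify ring.

Set Implicit Arguments.
Unset Strict Implicit.
Unset Printing Implicit Defensive.

(** Write D for the maximum degree.  Dependent random choice: inside a set A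
    pick 2D vertices at random and let U be their common neighbourhood in A in
    the more frequent colour.  On average U has size at least |A| / 2^(2D),
    while D-tuples of U with fewer than 2n common neighbours in A are so rare
    that some U with |A| <= 2^(2D+1) |U| has fewer than (n/D)^D of them.
    Iterating 2(q-1) times and keeping the colour that occurs q-1 times gives
    B_0 <= ... <= B_(q-1) in one colour, with |B_0| >= 2n because q <= D+1.
    The i-th colour class of H is embedded greedily into B_i.  The bound on poor
    tuples is absolute, not relative to |B_i|, so each not yet embedded
    neighbour of the current vertex forbids fewer than n/D images; together
    with the fewer than n images already used this leaves one of the at least
    2n candidates. *)

(** * Power means and greedy colouring *)

(** Induction on [t]. The step [cheb] is Chebyshev's sum inequality: [x, y] and [x ^ t, y ^ t] are
    ordered alike. *)
Lemma power_mean2 x y t : 2 * (x + y) ^ t <= 2 ^ t * (x ^ t + y ^ t).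
Proof.
elim: t => [|t IH]; first by rewrite !expn0.
have cheb : (x + y) * (x ^ t + y ^ t) <= 2 * (x ^ t.+1 + y ^ t.+1).
  rewrite !expnS; have [xy|/ltnW yx] := leqP x y.
    have le : x ^ t <= y ^ t by case: (t) => // ?; rewrite leq_exp2r.
    by nia.
  have le : y ^ t <= x ^ t by case: (t) => // ?; rewrite leq_exp2r.
  by nia.
rewrite [(x + y) ^ _]expnS [2 ^ _]expnS.
apply: (@leq_trans ((x + y) * (2 ^ t * (x ^ t + y ^ t)))).
  by rewrite mulnCA leq_mul2l IH orbT.
by rewrite mulnCA -mulnA [X in _ <= X]mulnCA leq_mul2l cheb orbT.
Qed.

Lemma degree_le (H : sgraph) (x : H) : degree x <= max_degree H.
Proof. exact: (leq_bigmax x). Qed.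

(** Greedy colouring: the at most [D] neighbours of a vertex leave one of [D.+1] colours free. *)
Lemma chromatic_number_le (H : sgraph) :
  chromatic_number H <= (max_degree H).+1.
Proof.
rewrite /chromatic_number; case: ex_minnP => k _; apply.
set D := max_degree H.
suff [f fP] : exists f : {ffun H -> 'I_D.+1},
    {in enum H &, forall x y, adj x y -> f x != f y}.
  apply/existsP; exists f; apply/forallP=> x; apply/forallP=> y.
  by apply/implyP; apply: fP; rewrite mem_enum.
elim: (enum H) => [|v s [f fP]]; first by exists [ffun=> ord0].
have [a aP] : exists a, a \notin f @: [set y | adj v y].
  apply/existsP; rewrite -negb_forall; apply/negP => /forallP all_im.
  have : #|f @: [set y | adj v y]| <= D.
    exact: leq_trans (leq_imset_card _ _) (degree_le v).
  rewrite (_ : _ @: _ = setT) ?cardsT ?card_ord ?ltnn //.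
  by apply/setP=> a; rewrite inE all_im.
have aN y : adj v y -> a != f y.
  by move=> vy; apply: contraNneq aP => ->; apply: imset_f; rewrite inE.
exists [ffun x => if x == v then a else f x] => x y.
rewrite !inE !ffunE; have [->|_] := eqVneq x v; have [->|_] := eqVneq y v => //=.
- by rewrite adj_irrefl.
- by move=> _ _ /aN.
- by rewrite adj_sym eq_sym => _ _ /aN.
exact: fP.
Qed.

(* The colour of [x] and [x] is allowed to be anything: keeping loops makes the
   two colour degrees in [A] add up to exactly [#|A|]. *)
Section TwoColoring.

Variables (V : finType) (c : V -> V -> bool).
Hypothesis c_sym : forall x y, c x y = c y x.

(** * Dependent random choice *)

Definition common b (l : seq V) (A : {set V}) :=
  [set y in A | all (fun x => c x y == b) l].

Definition poor_tuples b k m (U A : {set V}) :=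
  [set s : k.-tuple V | all [in U] s && (#|common b s A| < m)].

Lemma card_ffun_set t (A : {set V}) :
  #|[set T : {ffun 'I_t -> V} | T \in ffun_on [in A]]| = #|A| ^ t.
Proof. by rewrite cardsE card_ffun_on card_ord. Qed.

Lemma card_tuple_all k (A : {set V}) :
  #|[set s : k.-tuple V | all [in A] s]| = #|A| ^ k.
Proof.
have tofK : cancel (@tuple_of_finfun V k) (@finfun_of_tuple V k).
  exact: tuple_of_finfunK.
rewrite -card_ffun_set -(card_imset (mem [set T | _]) (can_inj tofK)).
apply: eq_card => s; rewrite inE; apply/idP/imsetP.
  move=> /allP sA; exists (finfun_of_tuple s); last by rewrite finfun_of_tupleK.
  rewrite inE; apply/ffun_onP => i; rewrite ffunE; apply: sA; exact: mem_tnth.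
case=> f; rewrite inE => /ffun_onP fA ->; apply/allP => x /tnthP[i ->].
by rewrite tnth_mktuple; apply: fA.
Qed.

(** Averaging over all [T] in [A ^ t], repetitions allowed. The weights [W] and [Z] bound the number
    of poor tuples by the fraction [Z / W] without division. *)
Lemma dependent_random_choice t k m W Z (A : {set V}) :
  2 ^ t.+1 * (W * (#|A| ^ k.+1 * m ^ t)) < Z * #|A| ^ t.+1 ->
  exists (b : bool) (U : {set V}), [/\ U \subset A, #|A| <= 2 ^ t.+1 * #|U|
                & W * #|poor_tuples b k m U A| < Z].
Proof.
move=> small; set F := [set T : {ffun 'I_t -> V} | T \in ffun_on [in A]].
have FP (T : {ffun _ -> V}) : reflect (forall i, T i \in A) (T \in F).
  by rewrite inE; apply: ffun_onP.
pose U b (T : {ffun 'I_t -> V}) := [set v in A | [forall i, c v (T i) == b]].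
pose dg b v := #|[set y in A | c v y == b]|.
have sumU b : \sum_(T in F) #|U b T| = \sum_(v in A) dg b v ^ t.
  transitivity
    (\sum_(T in F) \sum_(v in A) if [forall i, c v (T i) == b] then 1 else 0).
    apply: eq_bigr => T _; rewrite -big_mkcondr -sum1_card.
    by apply: eq_bigl => v; rewrite inE.
  rewrite exchange_big /=; apply: eq_bigr => v vA.
  rewrite -big_mkcondr sum1_card -card_ffun_set; apply: eq_card => T.
  rewrite !inE; apply/andP/ffun_onP.
    by case=> /FP TA /forallP Tb i; rewrite !inE TA Tb.
  move=> Th; split; first by apply/FP=> i; have := Th i; rewrite !inE => /andP[].
  by apply/forallP=> i; have := Th i; rewrite !inE => /andP[].
have dgD v : dg true v + dg false v = #|A|.
  by rewrite -(cardsID [set y | c v y] A); congr (_ + _); apply: eq_card => y;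
    rewrite !inE; case: (c v y); rewrite ?andbT ?andbF.
(* The two colour degrees of [v] sum to [#|A|], so [power_mean2] bounds the two colours together,
   and one of them reaches half the total. *)
have [b lowb] : exists b : bool, #|A| ^ t.+1 <= 2 ^ t * \sum_(T in F) #|U b T|.
  apply/existsP/contraT; rewrite negb_exists => /forallP no.
  have := no true; have := no false; rewrite -!ltnNge => ltf ltt.
  have : 2 * #|A| ^ t.+1 <= 2 ^ t * (\sum_(T in F) #|U true T|)
                          + 2 ^ t * (\sum_(T in F) #|U false T|).
    rewrite !sumU -mulnDr -big_split big_distrr expnS mulnCA -sum_nat_const /=.
    by apply: leq_sum => v _; rewrite -(dgD v) power_mean2.
  by lia.
(* A tuple lies in [U b T] only if every entry of [T] is one of its common neighbours, so a poor
   tuple survives for at most [m ^ t] choices of [T]. *)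
have sumP : \sum_(T in F) #|poor_tuples b k m (U b T) A| <= #|A| ^ k * m ^ t.
  pose Q (s : k.-tuple V) := all [in A] s && (#|common b s A| < m).
  apply: (@leq_trans (\sum_(s : k.-tuple V | Q s) #|common b s A| ^ t)).
    under eq_bigr => T _ do rewrite -sum1_card big_mkcond /=.
    rewrite exchange_big /= [X in _ <= X]big_mkcond /=; apply: leq_sum => s _.
    have [/andP[sA sm]|nQ] := boolP (Q s); last first.
      rewrite big1 // => T _; case: ifP => //; rewrite inE => /andP[/allP sU sm].
      case/negP: nQ; rewrite /Q sm andbT; apply/allP=> x /sU.
      by rewrite !inE => /andP[].
    rewrite -big_mkcondr sum1_card -card_ffun_set; apply: subset_leq_card.
    apply/subsetP=> T /andP[/FP TA]; rewrite !inE => /andP[/allP sU _].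
    apply/ffun_onP=> i; rewrite !inE; apply/andP; split; first exact: TA.
    by apply/allP=> x /sU; rewrite !inE => /andP[_ /forallP].
  apply: (@leq_trans (\sum_(s : k.-tuple V | all [in A] s) m ^ t)).
    rewrite [X in X <= _]big_mkcond [X in _ <= X]big_mkcond; apply: leq_sum => s _.
    rewrite /Q; case: (all _ _) => //=; case: ifP => // sm.
    by case: (t) => // ?; rewrite leq_exp2r // ltnW.
  by rewrite sum_nat_const -card_tuple_all cardsE.
have [T TF [TU TP]] : exists2 T, T \in F &
    #|A| <= 2 ^ t.+1 * #|U b T| /\ W * #|poor_tuples b k m (U b T) A| < Z.
  suff /exists_inP[T TF /andP[]] : [exists T in F,
      (#|A| <= 2 ^ t.+1 * #|U b T|) && (W * #|poor_tuples b k m (U b T) A| < Z)].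
    by exists T.
  apply/contraT; rewrite negb_exists_in => /forall_inP no; exfalso.
  (* If every [T] fails, the first term on the right pays when [U b T] is small, the second when it
     has too many poor tuples. The sum contradicts [lowb], [sumP] and [small]. *)
  have : \sum_(T in F) 2 ^ t.+1 * #|U b T| * Z <= \sum_(T in F)
      (#|A| * Z + 2 ^ t.+1 * #|A| * W * #|poor_tuples b k m (U b T) A|).
    apply: leq_sum => T /no; rewrite negb_and -ltnNge -leqNgt.
    case/orP=> [ltA|leZ].
      by apply: leq_trans (leq_addr _ _); rewrite leq_mul2r (ltnW ltA) orbT.
    apply: leq_trans (leq_addl _ _); rewrite -[X in _ <= X]mulnA.
    apply: leq_mul => //; rewrite leq_mul2l; apply/orP; right.
    by apply/subset_leq_card/subsetP=> v; rewrite inE => /andP[].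
  rewrite big_split /= sum_nat_const card_ffun_set.
  rewrite -big_distrr -big_distrl -big_distrr /=.
  move: small lowb sumP; rewrite !expnS.
  set S1 := \sum_(T in F) #|U b T|; set S2 := \sum_(T in F) _.
  move: (2 ^ t) (#|A| ^ t) (#|A| ^ k) (m ^ t) S1 S2 => p at' ak mt S1 S2.
  move=> small lowb sumP.
  rewrite leqNgt => /negP; apply.
  apply: (@leq_ltn_trans (at' * (#|A| * Z) + 2 * p * #|A| * W * (ak * mt))).
    by rewrite leq_add2l leq_mul2l sumP orbT.
  apply: (@leq_trans (at' * (#|A| * Z) + Z * (#|A| * at'))).
    by rewrite ltn_add2l; apply: leq_trans small; rewrite ltnS; nia.
  by nia.
exists b, (U b T); split => //.
by apply/subsetP=> v; rewrite inE => /andP[].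
Qed.

(** * Promising lists and poor tuples *)

Lemma card_tuple_cons d (P : pred (seq V)) :
  #|[set s : d.+1.-tuple V | P s]|
    = \sum_x #|[set s : d.-tuple V | P (x :: s)]|.
Proof.
rewrite -sum1_card (reindex (fun p : V * d.-tuple V => cons_tuple p.1 p.2)) /=.
  under [RHS]eq_bigr => x _ do rewrite -sum1_card.
  by rewrite pair_big_dep; apply: eq_bigl => -[x s]; rewrite !inE.
apply: onW_bij; exists (fun s => (thead s, behead_tuple s)).
  by case=> x s; congr (_, _); apply: val_inj.
by move=> s; rewrite [RHS]tuple_eta; apply: val_inj.
Qed.

(* [promising d l]: the list [l] of embedded vertices keeps enough room to
   receive [d] more vertices of [U] and still have [2 * n] common neighbours. *)
Fixpoint promising b D n (U A : {set V}) d (l : seq V) : bool :=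
  if d is d'.+1 then
    D * #|[set x in U | ~~ promising b D n U A d' (rcons l x)]| < n
  else 2 * n <= #|common b l A|.

(** Bad extensions are counted absolutely, so shrinking [U] can only discard some of them. *)
Lemma promisingS b D n (U U' A : {set V}) d l :
  U' \subset U -> promising b D n U A d l -> promising b D n U' A d l.
Proof.
move=> sU; elim: d l => //= d IH l; apply: leq_ltn_trans.
rewrite leq_mul2l subset_leq_card ?orbT //; apply/subsetP=> x; rewrite !inE.
by case/andP=> /(subsetP sU)->; apply: contra; apply: IH.
Qed.

(** Each of the [d] levels offers at least [n / D] bad extensions; following them yields
    [(n / D) ^ d] poor tuples. *)
Lemma not_promising b D n (U A : {set V}) d l :
  ~~ promising b D n U A d l ->
  n ^ d <= D ^ d *
    #|[set s : d.-tuple V | all [in U] s && (#|common b (l ++ s) A| < 2 * n)]|.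
Proof.
elim: d l => [|d IH] l /=.
  rewrite -ltnNge mul1n => lt; apply/card_gt0P; exists [tuple].
  by rewrite inE /= cats0.
rewrite -leqNgt; set X := [set x in U | _] => leX.
rewrite (card_tuple_cons d
  (fun s => all [in U] s && (#|common b (l ++ s) A| < 2 * n))).
rewrite !expnS; apply: leq_trans (leq_mul leX (leqnn _)) _.
rewrite -!mulnA leq_mul2l -sum_nat_const big_distrr /=; apply/orP; right.
rewrite [X in _ <= X](bigID [in X]) /=; apply: leq_trans (leq_addr _ _).
apply: leq_sum => x; rewrite inE => /andP[xU /IH].
rewrite (eq_card (_ : _ =i [set s : d.-tuple V |
  all [in U] (x :: s) && (#|common b (l ++ x :: s) A| < 2 * n)])) //.
by move=> s; rewrite !inE /= xU cat_rcons.
Qed.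

(** Fewer than [n / D] elements of [U] are bad, so a promising extension exists; extending the list
    only shrinks its common neighbourhood. *)
Lemma promising_common b D n (U A : {set V}) d l : 0 < D -> n <= #|U| ->
  promising b D n U A d l -> 2 * n <= #|common b l A|.
Proof.
move=> D_gt0 leU; elim: d l => //= d IH l ltX.
have [x xU px] : exists2 x, x \in U & promising b D n U A d (rcons l x).
  apply/exists_inP/contraT; rewrite negb_exists_in => /forall_inP no.
  rewrite (_ : [set x in U | _] = U) in ltX; first by nia.
  by apply/setP=> x; rewrite inE; case: (boolP (x \in U)) => //= /no.
apply: leq_trans (IH _ px) _; apply/subset_leq_card/subsetP=> y; rewrite !inE.
by rewrite all_rcons => /andP[-> /andP[]].
Qed.

(** * Chains in one colour *)

Lemma mono_pair D n (A : {set V}) : 0 < D -> 0 < n -> 64 * D * n <= #|A| ->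
  exists (b : bool) (U : {set V}), [/\ U \subset A,
    #|A| <= 2 ^ (2 * D + 1) * #|U| & promising b D n U A D [::]].
Proof.
move=> D_gt0 n_gt0 leA.
have [|b [U [sU leU poor]]] :=
  @dependent_random_choice (2 * D) D (2 * n) (D ^ D) (n ^ D) A.
  (* This is the smallness hypothesis after cancelling [#|A| ^ D.+1 * n ^ D]. It holds because
     [64 ^ D] exceeds [2 ^ (4 * D + 1)]. *)
  have ltA : 2 ^ (2 * D).+1 * (D ^ D * (2 ^ (2 * D) * n ^ D)) < #|A| ^ D.
    apply: (@leq_trans ((64 * D * n) ^ D)); last by rewrite leq_exp2r.
    have e64 : 64 ^ D = 2 ^ D * (2 ^ (2 * D) * 2 ^ (2 * D) * 2 ^ D).
      by rewrite -!expnD -[64]/(2 ^ 6) -expnM; congr (2 ^ _); ring.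
    rewrite !expnMn expnS e64.
    have lt2 : 1 < 2 ^ D by rewrite -{1}(expn0 2) ltn_exp2l.
    have := expn_gt0 D D; have := expn_gt0 n D; have := expn_gt0 2 (2 * D).
    rewrite D_gt0 n_gt0 /=.
    move: (2 ^ D) (2 ^ (2 * D)) (D ^ D) (n ^ D) lt2 => a p d e lt2 p0 e0 d0.
    have -> : a * (p * p * a) * d * e = (a * a) * (p * (d * (p * e))) by ring.
    have : 0 < p * (d * (p * e)) by rewrite !muln_gt0 p0 d0 e0.
    by rewrite -(mulnA 2 p) => /ltn_pmul2r->; nia.
  have A_gt0 : 0 < #|A| by apply: leq_trans leA; rewrite !muln_gt0 D_gt0 n_gt0.
  have pos : 0 < #|A| ^ D.+1 * n ^ D by rewrite muln_gt0 !expn_gt0 A_gt0 n_gt0.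
  have -> : n ^ D * #|A| ^ (2 * D).+1 = (#|A| ^ D.+1 * n ^ D) * #|A| ^ D.
    by rewrite mul2n -addnn -addSn expnD; ring.
  move: ltA; rewrite -(ltn_pmul2l pos); apply: leq_trans.
  rewrite ltnS expnMn [n ^ (2 * D)](_ : _ = n ^ D * n ^ D); last first.
    by rewrite -expnD addnn mul2n.
  by rewrite eq_leq //; ring.
exists b, U; split=> //; first by rewrite addn1.
apply/contraT=> /not_promising; rewrite leqNgt => /negP[].
exact: poor.
Qed.

(** Each use of [mono_pair] costs a factor [2 ^ (2 * D + 1)] and yields a link in one colour; [r]
    and [s] count the links still wanted in each, and the recursion stops when either is zero. *)
Lemma mono_chain D n r s (A : {set V}) : 0 < D -> 0 < n ->
  2 ^ ((2 * D + 1) * (r + s)) * (2 * n) <= #|A| ->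
  exists (b : bool) (B : nat -> {set V}), let k := if b then r else s in
  [/\ B k \subset A, 2 * n <= #|B 0| &
    forall i, i < k -> B i \subset B i.+1 /\
                       promising b D n (B i) (B i.+1) D [::]].
Proof.
move=> D_gt0 n_gt0.
have base e : 2 ^ e * (2 * n) <= #|A| -> 2 * n <= #|A|.
  by apply: leq_trans; rewrite leq_pmull // expn_gt0.
have [m] := ubnP (r + s); elim: m r s A base => // m IH [|r] s A base lem leA.
  by exists true, (fun=> A); split=> //; apply: base leA.
case: s => [|s] in lem leA *.
  by exists false, (fun=> A); split=> //; apply: base leA.
have [|b [U [sUA leU prU]]] := mono_pair (A := A) D_gt0 n_gt0.
  apply: leq_trans leA.
  (* Both counts are positive here, so two factors are available, and [8 * D <= 8 ^ D * 2 ^ D]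
     produces the constant 64. *)
  apply: (@leq_trans (2 ^ ((2 * D + 1) * 2) * (2 * n))); last first.
    by rewrite leq_mul2r leq_exp2l //; apply/orP; right; nia.
  have -> : 2 ^ ((2 * D + 1) * 2) = 8 ^ D * 2 ^ D * 4.
    by rewrite -[8]/(2 ^ 3) -[4]/(2 ^ 2) -expnM -!expnD; congr (2 ^ _); ring.
  have lt2 : D < 2 ^ D := ltn_expl D (isT : 1 < 2).
  have le8 : 8 ^ 1 <= 8 ^ D by rewrite leq_exp2l.
  have : 8 * D <= 8 ^ D * 2 ^ D by apply: leq_mul => //; apply: ltnW.
  by move: (8 ^ D * 2 ^ D) => z; nia.
have leU' x : x.+1 = r.+1 + s.+1 -> 2 ^ ((2 * D + 1) * x) * (2 * n) <= #|U|.
  move=> ex; rewrite -(leq_pmul2l (_ : 0 < 2 ^ (2 * D + 1))) ?expn_gt0 //.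
  by apply: leq_trans leU; rewrite mulnA -expnD -mulnS ex.
(* [A] goes on top of the chain found inside [U]; the new link is promising by [promisingS]. *)
have ext b' k (B : nat -> {set V}) : b' = b -> B k \subset U ->
  (forall i, i < k -> B i \subset B i.+1 /\
                      promising b' D n (B i) (B i.+1) D [::]) ->
  let B' i := if i <= k then B i else A in
  forall i, i < k.+1 -> B' i \subset B' i.+1 /\
                       promising b' D n (B' i) (B' i.+1) D [::].
  move=> -> sBU hB B' i; rewrite ltnS /B' => le_ik; rewrite le_ik.
  have [lt_ik|ge_ik] := ltnP i k; first exact: hB.
  have -> : i = k by apply/eqP; rewrite eqn_leq le_ik.
  by split; [apply: subset_trans sUA | apply: promisingS prU].
case: b prU ext => prU ext.
  have [|||b [B [sB B0 hB]]] := IH r s.+1 U; last first.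
  - case: b sB hB => sB hB; last first.
      by exists false, B; split=> //; apply: subset_trans sUA.
    exists true, (fun i => if i <= r then B i else A).
    by split; rewrite ?ltnn //; apply: ext.
  - by apply: leU'; lia.
  - by lia.
  by move=> e; apply: leq_trans; rewrite leq_pmull // expn_gt0.
have [|||b [B [sB B0 hB]]] := IH r.+1 s U; last first.
- case: b sB hB => sB hB.
    by exists true, B; split=> //; apply: subset_trans sUA.
  exists false, (fun i => if i <= s then B i else A).
  by split; rewrite ?ltnn //; apply: ext.
- by apply: leU'; lia.
- by lia.
by move=> e; apply: leq_trans; rewrite leq_pmull // expn_gt0.
Qed.


(** * Greedy embedding along a chain *)

(** Vertices are embedded by increasing [phi], so a neighbour [w] of [v] still to come has larger
    [phi], and the image of [v] falls in the lower set of the link below [B (phi w)]. *)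
Lemma embed_in_chain (H : sgraph) (phi : H -> nat) D k b (B : nat -> {set V}) :
  0 < D -> (forall x : H, degree x <= D) -> (forall x, phi x <= k) ->
  (forall x y, adj x y -> phi x != phi y) ->
  2 * #|H| <= #|B 0| ->
  (forall i, i < k -> B i \subset B i.+1 /\
                      promising b D #|H| (B i) (B i.+1) D [::]) ->
  exists2 f : H -> V, injective f & forall x y, adj x y -> c (f x) (f y) = b.
Proof.
set n := #|H| => D_gt0 degD phik phiN B0 hB.
have Bmono i j : i <= j -> j <= k -> B i \subset B j.
  elim: j => [|j IH]; first by rewrite leqn0 => /eqP->.
  rewrite leq_eqVlt => /orP[/eqP-> //|]; rewrite ltnS => le_ij lt_jk.
  by apply: subset_trans (IH le_ij (ltnW lt_jk)) _; have [] := hB _ lt_jk.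
have Bcard i : i <= k -> 2 * n <= #|B i|.
  by move=> le_ik; apply: leq_trans B0 (subset_leq_card (Bmono _ _ _ _)).
pose le_phi := relpre phi leq; pose vs := sort le_phi (enum H).
have vsP x : x \in vs by rewrite mem_sort mem_enum.
have uniq_vs : uniq vs by rewrite sort_uniq enum_uniq.
have size_vs : size vs = n by rewrite size_sort -cardE.
have sort_vs : pairwise le_phi vs.
  rewrite -sorted_pairwise; last by move=> y x z; apply: leq_trans.
  by apply: sort_sorted => x y; apply: leq_total.
pose nb (p : seq H) (w : H) := [seq u <- p | adj w u].
(* Last clause: the images of the embedded neighbours of [w] stay promising for the up to
   [D - size (nb p w)] others. Colour 0 is exempt, having no link below it. *)
pose inv (p : seq H) (f : H -> V) := [/\ {in p &, injective f}, {in p, forall u, f u \in B (phi u)},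
  {in p &, forall u v, adj u v -> c (f u) (f v) = b} &
  forall w j, w \notin p -> phi w = j.+1 ->
    promising b D n (B j) (B j.+1) (D - size (nb p w)) (map f (nb p w))].
suff main p r : vs = p ++ r -> exists f : H -> V, inv p f.
  have [f [f_inj _ f_adj _]] := main vs [::] (esym (cats0 _)).
  by exists f => [x y|x y]; [apply: f_inj | apply: f_adj].
elim/last_ind: p r => [|p v IH] r def_vs.
  (* An initial total [f] needs some point of [V]; if [B 0] is empty, so is [H]. *)
  have [n0|/card_gt0P[x0 _]] := posnP #|B 0|; last first.
    exists (fun=> x0); split=> // w j _ phiw; rewrite subn0.
    by have [] := hB j; rewrite // -phiw.
  have H0 : H -> False by move=> x; move: B0; rewrite n0 /n (cardD1 x) inE.
  by exists (fun x => False_rect V (H0 x)); split=> // w; case: (H0 w).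
rewrite cat_rcons in def_vs; have [f [f_inj f_B f_adj f_pr]] := IH _ def_vs.
have [vp uniq_p] : v \notin p /\ uniq p.
  move: uniq_vs; rewrite def_vs cat_uniq /= negb_or.
  by case/and3P=> -> /andP[].
have lt_p : size p < n by rewrite -size_vs def_vs size_cat /= addnS ltnS leq_addr.
have phi_p u w : u \in p -> w \notin p -> phi u <= phi w.
  move=> up wp; move: sort_vs; rewrite def_vs pairwise_cat => /andP[/allrelP + _].
  by apply=> //; have := vsP w; rewrite def_vs mem_cat (negPf wp).
have phi_v w : w \notin p -> phi v <= phi w.
  move=> wp; move: sort_vs; rewrite def_vs pairwise_cat /=.
  case/and4P=> _ _ /allP vr _; have := vsP w.
  by rewrite def_vs mem_cat (negPf wp) inE => /predU1P[->|/vr].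
have phi_lt w : w \notin p -> adj w v -> phi v < phi w.
  by move=> wp wv; rewrite ltn_neqAle phi_v // eq_sym phiN.
set C := common b (map f (nb p v)) (B (phi v)).
have leC : 2 * n <= #|C|.
  (* In colour 0 no neighbour is embedded yet, so [C] is all of [B 0]; otherwise the invariant at
     [v] applies. *)
  case def_j: (phi v) => [|j].
    rewrite /C (_ : nb p v = [::]) ?def_j /common /=.
      by rewrite (eq_card (_ : _ =i B 0)) // => y; rewrite inE andbT.
    apply/eqP; rewrite -size_eq0 size_filter -leqn0 leqNgt -has_count.
    apply/hasPn=> u up; apply: contraTN (phi_p u v up vp) => /phiN.
    by rewrite def_j leqn0 eq_sym.
  have lt_jk : j < k by rewrite -def_j.
  rewrite /C def_j; apply: promising_common (f_pr _ _ vp def_j) => //.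
  by apply: leq_trans (Bcard j (ltnW lt_jk)); rewrite leq_pmull.
pose W := [set w | adj v w & w \notin p].
(* The images of [v] that would spoil [w]. For [w] in [W], [phi w] is positive, so the predecessor
   is genuine. *)
pose X w := [set x in B (phi w).-1 | ~~ promising b D n (B (phi w).-1) (B (phi w))
  (D - size (nb p w)).-1 (rcons (map f (nb p w)) x)].
have nb_lt w : w \notin p -> adj w v -> size (nb p w) < D.
  move=> wp wv; apply: leq_trans (degD w); rewrite -[_.+1]/(size (v :: nb p w)).
  rewrite /degree cardE; apply: uniq_leq_size.
    by rewrite /= mem_filter (negPf vp) andbF filter_uniq.
  move=> u; rewrite mem_enum !inE => /predU1P[->//|].
  by rewrite mem_filter => /andP[].
have X_lt w : w \in W -> D * #|X w| < n.
  rewrite inE adj_sym => /andP[wv wp]; have lt_vw := phi_lt _ wp wv.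
  have def_w : phi w = (phi w).-1.+1 by rewrite prednK // (leq_trans _ lt_vw).
  have := f_pr _ _ wp def_w; rewrite -def_w.
  by have := nb_lt _ wp wv; rewrite -subn_gt0 /X; case: (D - size _).
have card_bigX : #|\bigcup_(w in W) X w| < n.
  have le_sum : #|\bigcup_(w in W) X w| <= \sum_(w in W) #|X w|.
    elim/big_rec2: _ => [|w m S _ leS]; first by rewrite cards0.
    by apply: leq_trans (leq_card_setU _ _) _; rewrite leq_add2l.
  apply: leq_ltn_trans le_sum _; rewrite -(ltn_pmul2l D_gt0) big_distrr /=.
  apply: (@leq_ltn_trans (\sum_(w in W) n.-1)).
    by apply: leq_sum => w /X_lt; case: (n).
  have leW : #|W| <= D.
    apply: leq_trans (degD v); apply: subset_leq_card.
    by apply/subsetP=> w; rewrite !inE => /andP[].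
  rewrite sum_nat_const; apply: leq_ltn_trans (leq_mul leW (leqnn _)) _.
  by rewrite ltn_pmul2l // prednK // (leq_trans _ lt_p).
have [x xC] : exists x, x \in C :\: ([set f u | u in p] :|: \bigcup_(w in W) X w).
  apply/card_gt0P; rewrite cardsD subn_gt0; apply: leq_trans leC.
  apply: leq_ltn_trans (subset_leq_card (subsetIr _ _)) _.
  apply: leq_ltn_trans (leq_card_setU _ _) _.
  have : #|[set f u | u in p]| < n.
    apply: leq_ltn_trans lt_p; apply: leq_trans (leq_imset_card _ _) _.
    exact: card_size.
  by lia.
have {xC} [xp xX xB xadj] : [/\ x \notin [set f u | u in p],
    forall w, w \in W -> x \notin X w, x \in B (phi v) &
    {in p, forall u, adj v u -> c (f u) x = b}].
  move: xC; rewrite in_setD in_setU negb_or => /andP[/andP[xp xX]].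
  rewrite inE => /andP[xB /allP xadj]; split=> //.
    by move=> w wW; apply: contra xX => xw; apply/bigcupP; exists w.
  move=> u up vu; apply/eqP/xadj/map_f; rewrite mem_filter vu.
  exact: up.
pose f' u := if u == v then x else f u.
have f'v : f' v = x by rewrite /f' eqxx.
have f'p u : u \in p -> f' u = f u.
  by move=> up; rewrite /f'; case: eqVneq => // uv; rewrite -uv up in vp.
have xf u : u \in p -> x != f u.
  by move=> up; apply: contraNneq xp => ->; apply: imset_f.
exists f'; split.
- move=> u w; rewrite !mem_rcons => /predU1P[->|up] /predU1P[->|wp] //.
  + by rewrite f'v f'p // => /eqP; rewrite (negPf (xf _ wp)).
  + by rewrite f'v f'p // => /esym/eqP; rewrite (negPf (xf _ up)).
  by rewrite !f'p //; apply: f_inj.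
- move=> u; rewrite mem_rcons => /predU1P[->|up]; first by rewrite f'v.
  by rewrite f'p // f_B.
- move=> u w; rewrite !mem_rcons => /predU1P[->|up] /predU1P[->|wp].
  + by rewrite adj_irrefl.
  + by rewrite f'v f'p // c_sym; apply: xadj.
  + by rewrite f'v f'p // adj_sym; apply: xadj.
  by rewrite !f'p //; apply: f_adj.
move=> w j; rewrite mem_rcons inE negb_or => /andP[_ wp] def_w.
rewrite /nb filter_rcons -/(nb p w).
have map_f' : map f' (nb p w) = map f (nb p w).
  by apply/eq_in_map => u; rewrite mem_filter => /andP[_ /f'p].
case: ifP => wv; last by rewrite map_f'; apply: f_pr.
rewrite map_rcons map_f' f'v size_rcons subnS.
have wW : w \in W by rewrite inE adj_sym wv.
have := xX _ wW; rewrite inE def_w /= negb_and negbK => /orP[/negP[]|//].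
have lt_jk : j < k by rewrite -def_w.
apply: (subsetP (Bmono (phi v) j _ (ltnW lt_jk))) => //.
by rewrite -ltnS -def_w phi_lt.
Qed.

End TwoColoring.

Theorem theorem1p5 (H : sgraph) (n q Delta : nat)
  (n_gt0 : 0 < n)
  (card_H : #|H| = n)
  (chi_H : chromatic_number H = q)
  (Delta_H : max_degree H = Delta) :
  ramsey_number H <= 2 ^ (4 * q * Delta) * n.
Proof.
set N := 2 ^ _ * n; rewrite /ramsey_number; case: ex_minnP => m _; apply.
have leN : n <= N by rewrite leq_pmull // expn_gt0.
rewrite (leq_trans n_gt0 leN) /=; apply/forallP=> c.
suff [b [f f_inj f_adj]] : exists b, exists2 f : H -> 'I_N, injective f &
    forall x y, adj x y -> c [set f x; f y] = b.
  apply/existsP; exists b; apply/existsP; exists (finfun f); apply/andP; split.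
    by apply/injectiveP=> x y; rewrite !ffunE => /f_inj.
  apply/forallP=> x; apply/forallP=> y; apply/implyP=> xy; rewrite !ffunE.
  exact/eqP/f_adj.
have deg (x : H) : degree x <= Delta by rewrite -Delta_H; apply: degree_le.
(* Without edges any injection works. *)
have [D0|D_gt0] := posnP Delta.
  have leHN : #|H| <= N by rewrite card_H.
  exists true, (fun x => widen_ord leHN (enum_rank x)) => [x y eqxy|x y xy].
    by apply/enum_rank_inj/val_inj; have := congr1 val eqxy.
  have := deg x; rewrite D0 leqn0 cards_eq0 => /eqP/setP/(_ y).
  by rewrite !inE xy.
have : colorable H q by rewrite -chi_H /chromatic_number; case: ex_minnP.
case/existsP=> phi /forallP phiP.
have [x0 _] : exists x0 : H, x0 \in H by apply/card_gt0P; rewrite card_H.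
have q_gt0 : 0 < q := leq_ltn_trans (leq0n _) (ltn_ord (phi x0)).
have leq_qD : q <= Delta.+1 by rewrite -chi_H -Delta_H chromatic_number_le.
have [|b [B [_ B0 hB]]] := @mono_chain _ (fun x y : 'I_N => c [set x; y])
    Delta n q.-1 q.-1 setT D_gt0 n_gt0.
  (* The exponent [(2 * Delta + 1) * (2 * (q - 1)) + 1] is at most [4 * q * Delta] once
     [q <= 2 * Delta], which follows from [q <= Delta.+1] and [0 < Delta]. *)
  rewrite cardsT card_ord /N mulnA leq_mul2r -expnSr leq_exp2l //.
  by apply/orP; right; nia.
rewrite if_same -card_H in B0 hB; exists b.
apply: (embed_in_chain (phi := fun x => phi x) _ D_gt0 deg _ _ B0 hB).
- by move=> x y; rewrite setUC.
- by move=> x; rewrite -ltnS prednK.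
by move=> x y xy; have /forallP/(_ y)/implyP/(_ xy) := phiP x.
Qed.
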